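(* Let $\mathcal G$ be a finite reduced collection of allowed words of $\Sigma_A$ (no word of $\mathcal G$ is a subword of another). Write $\mathcal G\setminus\Sigma$ for the words of $\mathcal G$ of length $\ge2$ and $\Sigma\setminus\mathcal G$ for the symbols not belonging to $\mathcal G$. For $i\in\Sigma\setminus\mathcal G$ let $F_i(z)=\sum_{n\ge1}\mu(n,i)z^n$, where $\mu(n,i)$ is the total $\mu$-measure of cylinders based at allowed words of length $n$ ending with $i$ and containing no word of $\mathcal G$ as a subword. For $u\in\mathcal G\setminus\Sigma$ let $G_u(z)=\sum_{n\ge1}\nu(n,u)z^n$, where $\nu(n,u)$ is the total $\mu$-measure of cylinders based at allowed words of length $n$ which contain no word of $\mathcal G$ as a subword except for a single occurrence of $u$ at the end. Then, as formal power series, for each $i\in\Sigma\setminus\mathcal G$ and each $u\in\mathcal G\setminus\Sigma$: $$F_i(z)-p_iz+\sum_{v\in\mathcal G\setminus\Sigma}\chi_{i,t(v)}G_v(z)=z\sum_{j\in\Sigma\setminus\mathcal G}F_j(z)P_{ji},$$ $$z^{|u|-1}\delta_uF_{i(u)}(z)=\sum_{v\in\mathcal G\setminus\Sigma}\tilde\tau_{v,u}(z)G_v(z).$$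
   Context: Let $\Sigma=\{1,\dots,N\}$, $A$ an irreducible $N\times N$ $0$–$1$ matrix, $\Sigma_A=\{x\in\Sigma^{\mathbb N}:A_{x_nx_{n+1}}=1\ \forall n\}$. A word is allowed if it occurs in some element of $\Sigma_A$; $C_w$ is the set of $x\in\Sigma_A$ beginning with $w$. $P$ is a row-stochastic matrix with $P_{ij}>0$ iff $A_{ij}=1$, $\mathbf p=(p_1,\dots,p_N)^T$ its stationary vector, $\mu=\mu_P$ the Markov measure $\mu(C_w)=p_{w_1}P_{w_1w_2}\cdots P_{w_{n-1}w_n}$. For a word $u$: $|u|$ is its length, $i(u)$ its first symbol, $t(u)$ its last symbol; $\chi_{a,b}=1$ if $a=b$ and $0$ otherwise; $\delta_u=P_{u_1u_2}\cdots P_{u_{\ell-1}u_\ell}$ for $u=u_1\cdots u_\ell$. Weighted correlation polynomial: for $u=u_1\cdots u_\ell$, $v=v_1\cdots v_m$ with $\ell,m\ge2$ and $0\le s\le\ell-1$, write $s\in(u,v)$ if $\ell-s\le m$ and $u_{s+1}\cdots u_\ell=v_1\cdots v_{\ell-s}$; $c_{s,u,v}=1$ if $s\in(u,v)$ and $0$ otherwise; $\delta_{s,u,v}=\prod_{j=\ell-s}^{m-1}P_{v_jv_{j+1}}$ (empty product $=1$). Then $\tau_{u,v}(z)=\sum_s c_{s,u,v}\delta_{s,u,v}z^{m+s-\ell}$, the sum over $0\le s\le\ell-1$ if $\ell<m$ and over $\ell-m\le s\le\ell-1$ if $\ell\ge m$. Finally $\tilde\tau_{v,u}(z)=\tau_{v,u}(z)-z^{|u|-1}c_{|v|-1,v,u}\delta_u$.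 *)

(* Defs.v *)
From mathcomp Require Import all_boot all_order all_algebra.
From mathcomp Require Import boolp.
Set Implicit Arguments. Unset Strict Implicit. Unset Printing Implicit Defensive.
Import Order.TTheory GRing.Theory Num.Theory.
Local Open Scope ring_scope.

(* Symbols are 'I_N (the paper's {1,...,N}, shifted to 0-based). Words are seq 'I_N. *)

(* A is a 0-1 matrix, encoded as a boolean matrix (entry 1 <-> true). *)
(* Irreducible: for all i j, (A^n)_{ij} > 0 for some n >= 1, i.e. there is an
   A-walk of length n >= 1 from i to j. *)
Definition irreducible01 (N : nat) (A : 'M[bool]_N) : Prop :=
  forall i j : 'I_N, exists w : seq 'I_N,
    w != [::] /\ path (fun a b => A a b) i w /\ last i w = j.

Definition in_SigmaA (N : nat) (A : 'M[bool]_N) (x : nat -> 'I_N) : Prop :=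
  forall k, A (x k) (x k.+1).

Definition allowed (N : nat) (A : 'M[bool]_N) (w : seq 'I_N) : Prop :=
  exists x : nat -> 'I_N, in_SigmaA A x /\
    exists k, w = mkseq (fun j => x (k + j)%N) (size w).

Definition deltaw (R : ringType) (N : nat) (P : 'M[R]_N) (w : seq 'I_N) : R :=
  \prod_(ab <- zip w (behead w)) P ab.1 ab.2.

Definition muC (R : ringType) (N : nat) (p : 'I_N -> R) (P : 'M[R]_N)
  (w : seq 'I_N) : R :=
  if w is a :: _ then p a * deltaw P w else 1.

Definition endsym (N : nat) (w : seq 'I_N) (i : 'I_N) : bool :=
  if w is a :: w' then last a w' == i else false.

Definition occurs_at (N : nat) (g w : seq 'I_N) (k : nat) : Prop :=
  (k + size g <= size w)%N /\ take (size g) (drop k w) = g.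

Definition avoids (N : nat) (G : seq (seq 'I_N)) (w : seq 'I_N) : Prop :=
  forall g, g \in G -> forall k, ~ occurs_at g w k.

Definition only_end_occ (N : nat) (G : seq (seq 'I_N)) (u w : seq 'I_N) : Prop :=
  occurs_at u w (size w - size u)%N /\
  forall g, g \in G -> forall k, occurs_at g w k ->
    g = u /\ (k + size g)%N = size w.

(* Formal power series over R are represented by their coefficient sequences. *)
Definition zpow (R : ringType) (k : nat) : nat -> R := fun n => (n == k)%:R.

Definition ps_mul (R : ringType) (a b : nat -> R) : nat -> R :=
  fun n => \sum_(k < n.+1) a k * b (n - k)%N.

Definition Fser (R : ringType) (N : nat) (A : 'M[bool]_N) (p : 'I_N -> R)
  (P : 'M[R]_N) (G : seq (seq 'I_N)) (i : 'I_N) : nat -> R :=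
  fun n => if n is 0 then 0 else
    \sum_(t : n.-tuple 'I_N |
            `[< allowed A t /\ endsym t i /\ avoids G t >]) muC p P t.

Definition Gser (R : ringType) (N : nat) (A : 'M[bool]_N) (p : 'I_N -> R)
  (P : 'M[R]_N) (G : seq (seq 'I_N)) (u : seq 'I_N) : nat -> R :=
  fun n => if n is 0 then 0 else
    \sum_(t : n.-tuple 'I_N |
            `[< allowed A t /\ only_end_occ G u t >]) muC p P t.

Definition cidx (N : nat) (s : nat) (u v : seq 'I_N) : bool :=
  ((size u - s <= size v)%N && (drop s u == take (size u - s) v)).

(* delta_{s,u,v} = prod_{j=l-s}^{m-1} P_{v_j v_{j+1}} = delta of v_{l-s} ... v_m *)
Definition delta_s (R : ringType) (N : nat) (P : 'M[R]_N) (s : nat)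
  (u v : seq 'I_N) : R :=
  deltaw P (drop (size u - s).-1 v).

Definition tau (R : ringType) (N : nat) (P : 'M[R]_N) (u v : seq 'I_N) : nat -> R :=
  fun k => \sum_(s < size u |
      [&& (if (size u < size v)%N then true else (size u - size v <= s)%N),
          cidx s u v & (size v + s - size u == k)%N])
    (cidx s u v)%:R * delta_s P s u v.

Definition tautilde (R : ringType) (N : nat) (P : 'M[R]_N) (v u : seq 'I_N) : nat -> R :=
  fun k => tau P v u k
           - zpow R (size u).-1 k * (cidx (size v).-1 v u)%:R * deltaw P u.

(* Main.v *)
Require Import Defs.
From mathcomp Require Import all_boot all_order all_algebra.
From mathcomp Require Import boolp zify.
Set Implicit Arguments. Unset Strict Implicit. Unset Printing Implicit Defensive.
Import Order.TTheory GRing.Theory Num.Theory.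
Local Open Scope ring_scope.

(* Words of zero measure may be ignored, so allowedness drops out and every
   coefficient becomes a sum of [muC] over all words of length [n] weighted by an
   indicator. Since [G] is reduced, for every word [w] the number of [v] in [G]
   whose only occurrence in [w] is at the end is the indicator that [w] without
   its last letter avoids [G] minus the indicator that [w] avoids [G]. The first
   identity is this fact for words ending in [i]. For the second, both sides are
   sums over the words [w] ending in [u]: on the left those whose prefix up to the
   first letter of [u] avoids [G], on the right those in which the first completed
   word [v] of [G] overlaps [u] in at least two letters. Telescoping the fact
   above over the prefixes of [w] ending inside [u] shows that they agree. *)

(** * Suffixes, occurrences and avoidance of words *)

Lemma suffix_comparable (T : eqType) (a b w : seq T) :
  suffix a w -> suffix b w -> (size a <= size b)%N -> suffix a b.
Proof.
move=> /suffixP[x ->] /suffixP[y exy] le_ab.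
have le_yx : (size y <= size x)%N.
  by move: (congr1 size exy); rewrite !size_cat; lia.
have/(congr1 (drop (size y))) := exy.
rewrite [in RHS]drop_size_cat // drop_cat.
case: ltngtP le_yx => // [lt_yx _ <-|eq_yx _].
  exact: suffix_suffix.
by rewrite eq_yx subnn drop0 => <-; exact: suffix_refl.
Qed.

Lemma endsymE (N : nat) (w : seq 'I_N) (i : 'I_N) :
  endsym w i = suffix [:: i] w.
Proof.
case/lastP: w => [|w j]; first by rewrite suffixs0.
rewrite -[[:: i]]/(rcons [::] i) suffix_rcons suffix0s andbT eq_sym.
by case: w => //= a w; rewrite last_rcons.
Qed.

Lemma occurs_atP (N : nat) (g w : seq 'I_N) (k : nat) :
  occurs_at g w k <-> exists2 x, size x = k & exists y, w = x ++ g ++ y.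
Proof.
split=> [[lek egk]|[x <- [y ->]]].
  exists (take k w); first by rewrite size_takel //; lia.
  exists (drop (size g) (drop k w)).
  by rewrite -{1}egk !cat_take_drop.
by split; rewrite ?size_cat ?drop_size_cat ?take_size_cat //; lia.
Qed.

Definition avoidsb (N : nat) (G : seq (seq 'I_N)) (w : seq 'I_N) : bool :=
  all (fun g => ~~ infix g w) G.

(** Boolean form of [only_end_occ]. An occurrence that stops before the last letter lies in [w]
    without that letter, so avoidance by this prefix is the right condition. *)
Definition end_occ (N : nat) (G : seq (seq 'I_N)) (v w : seq 'I_N) : bool :=
  suffix v w && avoidsb G (take (size w).-1 w).

Definition reduced (N : nat) (G : seq (seq 'I_N)) : Prop :=
  {in G &, forall u v, u != v -> ~~ infix u v}.

Lemma avoidsP (N : nat) (G : seq (seq 'I_N)) (w : seq 'I_N) :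
  reflect (avoids G w) (avoidsb G w).
Proof.
apply: (iffP allP) => [av g gG k /occurs_atP[x _ [y ew]]|av g gG].
  by move/negP: (av g gG); apply; rewrite ew infix_infix.
apply/negP => /infixP[x [y ew]]; apply: (av g gG (size x)).
by apply/occurs_atP; exists x => //; exists y.
Qed.

Lemma avoidsb_infix (N : nat) (G : seq (seq 'I_N)) (x w : seq 'I_N) :
  infix x w -> avoidsb G w -> avoidsb G x.
Proof.
move=> xw /allP av; apply/allP => g /av; apply: contra => gx.
exact: infix_trans gx xw.
Qed.

(** Of two suffixes of one word the shorter is a suffix of the longer, which reducedness forbids for
    distinct words. *)
Lemma reduced_suffix_inj (N : nat) (G : seq (seq 'I_N)) (g v w : seq 'I_N) :
  reduced G -> g \in G -> v \in G -> suffix g w -> suffix v w -> g = v.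
Proof.
move=> redG gG vG sgw svw; apply/eqP; case: (boolP (g == v)) => // ne_gv.
case/orP: (leq_total (size g) (size v)) => le.
  by have := redG _ _ gG vG ne_gv; rewrite (suffixW (suffix_comparable sgw svw le)).
rewrite eq_sym in ne_gv; have := redG _ _ vG gG ne_gv.
by rewrite (suffixW (suffix_comparable svw sgw le)).
Qed.

Lemma only_end_occP (N : nat) (G : seq (seq 'I_N)) (v w : seq 'I_N) :
  reduced G -> [::] \notin G -> v \in G ->
  only_end_occ G v w <-> end_occ G v w.
Proof.
move=> redG nilG vG; have v0 : (0 < size v)%N by case: v vG nilG => // ->.
split=> [[occv only]|/andP[svw av]].
  apply/andP; split.
    have/occurs_atP[x sx [y ew]] := occv.
    have : size y = 0%N.
      by move: sx; rewrite ew !size_cat; case: occv; lia.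
    by move/size0nil=> y0; rewrite ew y0 cats0 suffix_suffix.
  apply/avoidsP => g gG k /occurs_atP[x sx [y ew]].
  have : occurs_at g w k.
    apply/occurs_atP; exists x => //; exists (y ++ drop (size w).-1 w).
    by rewrite -{1}(cat_take_drop (size w).-1 w) ew -!catA.
  case/(only g gG)=> _; have := congr1 size ew; rewrite !size_cat sx.
  have g0 : (0 < size g)%N by case: g gG nilG {ew} => // ->.
  by rewrite size_takel ?leq_pred //; move: (size g) g0 => l; lia.
split.
  case/suffixP: svw => x ->; apply/occurs_atP.
  by exists x; [rewrite size_cat addnK | exists [::]; rewrite cats0].
move=> g gG k /occurs_atP[x sx [y ew]].
(* If some letter follows the occurrence of [g], it already occurs in [w] without its last letter;
   otherwise [g] and [v] are suffixes of the same word. *)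
case/lastP: y ew => [|y b] ew; last first.
  case/avoidsP/(_ g gG k): av; apply/occurs_atP; exists x => //; exists y.
  rewrite ew -!rcons_cat size_rcons -cats1 take_size_cat //.
have sgw : suffix g w by rewrite ew cats0 suffix_suffix.
split; last by rewrite ew !size_cat /=; lia.
exact: (reduced_suffix_inj redG gG vG sgw svw).
Qed.

(* Appending one letter either keeps the word free of [G] or creates an
   occurrence at the end, of a single [v] since [G] is reduced. *)
Lemma sum_end_occ (R : pzRingType) (N : nat) (G : seq (seq 'I_N)) (w : seq 'I_N) :
  uniq G -> reduced G -> [::] \notin G ->
  \sum_(v <- G) (end_occ G v w)%:R
  = (avoidsb G (take (size w).-1 w))%:R - (avoidsb G w)%:R :> R.
Proof.
move=> uG redG nilG; rewrite /end_occ; case av': (avoidsb G (take _ w)); last first.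
  have -> : avoidsb G w = false.
    by apply: contraFF av'; apply/avoidsb_infix/infix_take.
  by rewrite subrr big1 // => v _; rewrite andbF.
under eq_bigr do rewrite andbT.
case: (boolP (has (fun g => suffix g w) G)) => [/hasP[v vG svw]|/hasPn nsuf].
  have -> : avoidsb G w = false.
    by apply/negP => /allP/(_ v vG)/negP; apply; exact: suffixW.
  rewrite (bigD1_seq v) //= svw big1_seq ?subr0 ?addr0 // => g /andP[ne_gv gG].
  case sgw: (suffix g w) => //.
  by rewrite (reduced_suffix_inj redG gG vG sgw svw) eqxx in ne_gv.
rewrite big1_seq => [|g /andP[_ /nsuf/negPf->]] //.
suff -> : avoidsb G w by rewrite subrr.
case/lastP: w av' nsuf => // w b; rewrite size_rcons /= -cats1 take_size_cat //.
move=> /allP av nsuf; apply/allP => g gG.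
by rewrite cats1 infix_rconsl -cats1 negb_or nsuf ?av.
Qed.

(** * Sums over all words of a given length *)

Definition wsum (R : pzRingType) (N n : nat) (f : seq 'I_N -> R) : R :=
  \sum_(t : n.-tuple 'I_N) f t.

Lemma eq_wsum (R : pzRingType) (N n : nat) (f g : seq 'I_N -> R) :
  (forall w, size w = n -> f w = g w) -> wsum n f = wsum n g.
Proof. by move=> fg; apply: eq_bigr => t _; rewrite fg ?size_tuple. Qed.

Lemma wsumD (R : pzRingType) (N n : nat) (f g : seq 'I_N -> R) :
  wsum n f + wsum n g = wsum n (fun w => f w + g w).
Proof. by rewrite /wsum big_split. Qed.

Lemma wsum_sum (R : pzRingType) (N n : nat) (I : Type) (r : seq I) (Q : pred I)
    (f : I -> seq 'I_N -> R) :
  \sum_(i <- r | Q i) wsum n (f i) = wsum n (fun w => \sum_(i <- r | Q i) f i w).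
Proof. by rewrite /wsum exchange_big. Qed.

Lemma wsumZl (R : pzRingType) (N n : nat) (c : R) (f : seq 'I_N -> R) :
  c * wsum n f = wsum n (fun w => c * f w).
Proof. by rewrite /wsum mulr_sumr. Qed.

Lemma wsumZr (R : pzRingType) (N n : nat) (c : R) (f : seq 'I_N -> R) :
  wsum n f * c = wsum n (fun w => f w * c).
Proof. by rewrite /wsum mulr_suml. Qed.

Lemma wsum0 (R : pzRingType) (N : nat) (f : seq 'I_N -> R) :
  wsum 0 f = f [::].
Proof.
rewrite /wsum (big_pred1 [tuple]) // => t.
by rewrite [t]tuple0; apply/esym/eqP.
Qed.

(** Appending [c] is a bijection from words of length [m] onto words of length [n] ending in [c].
    This brings both sides of an identity to sums over words of the same length. *)
Lemma wsum_append (R : pzRingType) (N m n : nat) (c : seq 'I_N)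
    (f : seq 'I_N -> R) :
  (m + size c)%N = n ->
  wsum m (fun x => f (x ++ c)) = wsum n (fun w => (drop m w == c)%:R * f w).
Proof.
move=> <-; rewrite /wsum.
under [RHS]eq_bigr do rewrite mulr_natl mulrb.
rewrite -big_mkcond /=.
have szt (w : (m + size c).-tuple 'I_N) : size (take m w) == m.
  by rewrite size_takel // size_tuple leq_addr.
rewrite [RHS](reindex_onto (fun x : m.-tuple 'I_N => cat_tuple x (in_tuple c))
   (fun w => Tuple (szt w))) /=.
  apply: eq_big => // x; apply/esym/andP; split.
    by rewrite drop_size_cat ?size_tuple.
  by apply/eqP/val_inj; rewrite /= take_size_cat ?size_tuple.
by move=> w /eqP ec; apply/val_inj; rewrite /= -[in RHS](cat_take_drop m w) ec.
Qed.

(** * The Markov measure and allowed words *)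

Lemma deltaw1 (R : nzRingType) (N : nat) (P : 'M[R]_N) (a : 'I_N) :
  deltaw P [:: a] = 1.
Proof. by rewrite /deltaw big_nil. Qed.

Lemma deltaw_cons2 (R : nzRingType) (N : nat) (P : 'M[R]_N) (a b : 'I_N) w :
  deltaw P (a :: b :: w) = P a b * deltaw P (b :: w).
Proof. by rewrite /deltaw /= big_cons. Qed.

(** The letter [a] is repeated in the second factor so that the transition across the cut is
    counted. *)
Lemma deltaw_cat (R : nzRingType) (N : nat) (P : 'M[R]_N) (a : 'I_N) x y :
  deltaw P (rcons x a ++ y) = deltaw P (rcons x a) * deltaw P (a :: y).
Proof.
elim: x => [|b x IH]; first by rewrite deltaw1 mul1r.
case: x IH => [|c x] IH /=; first by rewrite !deltaw_cons2 deltaw1 mulr1.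
by rewrite !deltaw_cons2 -mulrA; congr (_ * _).
Qed.

Lemma muC_cat (R : nzRingType) (N : nat) (p : 'I_N -> R) (P : 'M[R]_N)
    (a : 'I_N) x y :
  muC p P (rcons x a ++ y) = muC p P (rcons x a) * deltaw P (a :: y).
Proof.
by have := deltaw_cat P a x y; case: x => [|b x] /= e; rewrite [in LHS]e mulrA.
Qed.

(** By irreducibility every symbol has a successor, so a finite walk extends to an infinite one. *)
Lemma path_allowed (N : nat) (A : 'M[bool]_N) (a : 'I_N) (w : seq 'I_N) :
  irreducible01 A -> path (fun b c => A b c) a w -> allowed A (a :: w).
Proof.
move=> irrA aw.
(* The first letter of a nonempty closed walk at [i] is a successor of [i]. *)
have /choice[f fA] : forall i : 'I_N, exists j, A i j.
  by move=> i; have [[|j x] [ne [ij _]]] := irrA i i => //; case/andP: ij; exists j.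
(* The sequence reads the word [a :: w] and then follows the chosen successors from its last
   letter. *)
pose x k := if (k <= size w)%N then nth a (a :: w) k
            else iter (k - size w)%N f (last a w).
have xE k : (size w <= k)%N -> x k = iter (k - size w)%N f (last a w).
  rewrite /x leq_eqVlt => /orP[/eqP <-|]; last by rewrite ltnNge => /negPf ->.
  by rewrite leqnn subnn /= nth_last.
exists x; split.
  move=> k; case: (leqP (size w) k) => [le_wk|lt_kw].
    by rewrite !xE ?(leqW le_wk) // subSn //=; apply: fA.
  by rewrite /x (ltnW lt_kw) lt_kw; exact: (pathP a aw).
exists 0%N; apply: (@eq_from_nth _ a); first by rewrite size_mkseq.
by move=> k lt_k; rewrite nth_mkseq // add0n /x -ltnS lt_k.
Qed.

(** Such a word is not a walk of [A], so one of its transition probabilities vanishes. *)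
Lemma muC_not_allowed (R : realFieldType) (N : nat) (A : 'M[bool]_N)
    (P : 'M[R]_N) (p : 'I_N -> R) (w : seq 'I_N) :
  irreducible01 A -> (forall i j, 0 <= P i j) ->
  (forall i j, (0 < P i j) = A i j) ->
  w != [::] -> ~ allowed A w -> muC p P w = 0.
Proof.
case: w => // a w irrA P0 PA _ nall /=.
suff: ~~ path (fun b c => A b c) a w -> deltaw P (a :: w) = 0.
  by case: (boolP (path _ _ _)) => [/path_allowed-/(_ irrA)//|_ -> //]; rewrite mulr0.
elim: w a {nall} => //= b w IH a; rewrite negb_and deltaw_cons2.
case/orP => [|/IH ->]; last by rewrite mulr0.
by rewrite -PA lt_def P0 andbT negbK => /eqP ->; rewrite mul0r.
Qed.

(** * Coefficients of the series as weighted sums over all words *)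

Lemma Fser_wsum (R : realFieldType) (N : nat) (A : 'M[bool]_N)
    (P : 'M[R]_N) (p : 'I_N -> R) (G : seq (seq 'I_N)) (i : 'I_N) (n : nat) :
  irreducible01 A -> (forall i j, 0 <= P i j) ->
  (forall i j, (0 < P i j) = A i j) ->
  Fser A p P G i n
  = wsum n (fun w => (suffix [:: i] w && avoidsb G w)%:R * muC p P w).
Proof.
move=> irrA P0 PA; case: n => [|n] /=; first by rewrite wsum0 suffixs0 mul0r.
rewrite big_mkcond; apply: eq_bigr => t _ /=; rewrite mulr_natl mulrb.
rewrite -endsymE; case: asboolP => [[_ [-> /avoidsP ->]] //|nH].
case: andP => // -[ei /avoidsP av]; apply/esym/(muC_not_allowed (A := A)) => //.
  by case: t {nH av} ei => -[].
by move=> al; apply: nH.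
Qed.

Lemma Gser_wsum (R : realFieldType) (N : nat) (A : 'M[bool]_N)
    (P : 'M[R]_N) (p : 'I_N -> R) (G : seq (seq 'I_N)) (v : seq 'I_N) (n : nat) :
  irreducible01 A -> (forall i j, 0 <= P i j) ->
  (forall i j, (0 < P i j) = A i j) ->
  reduced G -> [::] \notin G -> v \in G ->
  Gser A p P G v n = wsum n (fun w => (end_occ G v w)%:R * muC p P w).
Proof.
move=> irrA P0 PA redG nilG vG; case: n => [|n] /=.
  rewrite wsum0 /end_occ suffixs0; case: eqP => [v0|_]; last by rewrite mul0r.
  by rewrite -v0 vG in nilG.
rewrite big_mkcond; apply: eq_bigr => t _ /=; rewrite mulr_natl mulrb.
have occP := only_end_occP t redG nilG vG.
case: asboolP => [[_ /occP ->] //|nH].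
case: (boolP (end_occ _ _ _)) => // /occP ov; apply/esym/(muC_not_allowed (A := A)) => //.
  by case: t {nH occP ov} => -[].
by move=> al; apply: nH.
Qed.

Lemma ps_mul_zpow (R : nzRingType) (k n : nat) (b : nat -> R) :
  ps_mul (zpow R k) b n = (k <= n)%:R * b (n - k)%N.
Proof.
rewrite /ps_mul /zpow; case: leqP => [le_kn|lt_nk]; last first.
  rewrite mul0r big1 // => j _; case: eqP => [ejk|_]; last by rewrite mul0r.
  by have := ltn_ord j; lia.
rewrite (bigD1 (Ordinal (le_kn : (k < n.+1)%N))) //= eqxx big1 ?addr0 // => j.
by rewrite -val_eqE /= => /negPf ->; rewrite mul0r.
Qed.

(** * The first identity *)

(** For [w] ending in [i], every [v] of [G] that ends [w] also ends in [i], and it has length at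
    least two because [[:: i]] is not in [G]. Hence the restricted sum equals the full one of
    [sum_end_occ]. *)
Lemma sum_end_occ_last (R : pzRingType) (N : nat) (G : seq (seq 'I_N))
    (i : 'I_N) (w : seq 'I_N) :
  uniq G -> reduced G -> [::] \notin G -> [:: i] \notin G ->
  (suffix [:: i] w && avoidsb G w)%:R
    + \sum_(v <- G | (1 < size v)%N) (endsym v i && end_occ G v w)%:R
  = (suffix [:: i] w && avoidsb G (take (size w).-1 w))%:R :> R.
Proof.
move=> uG redG nilG iG; case si: (suffix [:: i] w) => /=; last first.
  rewrite add0r big1 // => v _; rewrite endsymE; case: andP => // -[iv /andP[vw _]].
  by rewrite (suffix_trans iv vw) in si.
rewrite -[RHS](subrK (avoidsb G w)%:R) -sum_end_occ // addrC; congr (_ + _).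
rewrite big_mkcond; apply: eq_big_seq => v vG.
case vw: (end_occ G v w); last by rewrite andbF if_same.
have {}vw : suffix v w by case/andP: vw.
have v0 : (0 < size v)%N by case: v vG nilG {vw} => // ->.
have iv : suffix [:: i] v by apply: suffix_comparable si vw v0.
rewrite endsymE iv /=; case: ltnP => // v1.
case: v iv v1 vG {vw v0} => [|j [|//]] //= /suffixP[[|b [|//]]] //= [->] _ iG'.
by rewrite iG' in iG.
Qed.

(** The factor [P j i] appends the letter [i]. Restricting [j] loses nothing, since a word avoiding
    [G] cannot end in a letter belonging to [G]. *)
Lemma sum_Fser_mulP (R : realFieldType) (N : nat) (A : 'M[bool]_N)
    (P : 'M[R]_N) (p : 'I_N -> R) (G : seq (seq 'I_N)) (i : 'I_N) (m : nat) :
  irreducible01 A -> (forall i j, 0 <= P i j) ->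
  (forall i j, (0 < P i j) = A i j) ->
  \sum_(j < N | [:: j] \notin G) Fser A p P G j m.+1 * P j i
  = wsum m.+2 (fun w => (suffix [:: i] w && avoidsb G (take (size w).-1 w))%:R
                        * muC p P w).
Proof.
move=> irrA P0 PA.
under eq_bigr do rewrite (Fser_wsum _ _ _ _ irrA P0 PA) wsumZr.
rewrite wsum_sum.
pose f w := (avoidsb G (take m.+1 w))%:R * muC p P w.
transitivity (wsum m.+1 (fun x => f (x ++ [:: i]))).
  apply: eq_wsum => w; case/lastP: w => // x a; rewrite size_rcons => -[sx].
  have sE j : suffix [:: j] (rcons x a) = (j == a).
    by rewrite -[[:: j]]/(rcons [::] j) suffix_rcons suffix0s andbT.
  under eq_bigr do rewrite sE.
  rewrite /f take_size_cat ?size_rcons ?sx // muC_cat deltaw_cons2 deltaw1 mulr1.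
  case av: (avoidsb _ _); last first.
    by rewrite mul0r big1 // => j _; rewrite andbF !mul0r.
  have aG : [:: a] \notin G.
    apply/negP => aG; move/allP/(_ _ aG)/negP: av; apply.
    by apply: suffixW; rewrite sE.
  rewrite (bigD1 a) //= eqxx !mul1r big1 ?addr0 // => j /andP[_ /negPf ->].
  by rewrite !mul0r.
rewrite (wsum_append (n := m.+2)) /= ?addn1 //; apply: eq_wsum => w sw.
by rewrite /f suffixE sw /= subn1 /= mulrA -natrM mulnb.
Qed.

(** * Correlation polynomials and the second identity *)

(** The exponent [k] determines the shift [s], so at most one term survives: the one whose overlap
    is the prefix of [u] of length [size u - k]. *)
Lemma tauE (R : nzRingType) (N : nat) (P : 'M[R]_N) (v u : seq 'I_N) (k : nat) :
  tau P v u k = ((k < size u)%N && suffix (take (size u - k) u) v)%:R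
                * deltaw P (drop (size u - k).-1 u).
Proof.
rewrite /tau /cidx /delta_s; case: (boolP (_ && _)) => [/andP[ku uv]|nuv]; last first.
  rewrite mul0r big_pred0 // => s; apply: contraNF nuv.
  move=> /and3P[_ /andP[les /eqP es] /eqP <-].
  have := ltn_ord s => lts; apply/andP; split; first by lia.
  have -> : (size u - (size u + s - size v) = size v - s)%N by lia.
  by rewrite -es suffix_drop.
have le_uv : (size u - k <= size v)%N.
  by rewrite -(size_takel (leq_subr k (size u))); exact: size_suffix.
(* This is the only shift giving the exponent [k]. *)
have lts : (size v - (size u - k) < size v)%N by lia.
have es : drop (size v - (size u - k)) v = take (size u - k) u.
  by move: uv; rewrite suffixE size_takel ?leq_subr // => /eqP.
have ek : (size v - (size v - (size u - k)) = size u - k)%N by lia.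
rewrite (bigD1 (Ordinal lts)) /=; last first.
  by rewrite es ek eqxx leq_subr /=; apply/andP; split; [case: ltnP => // _|]; lia.
rewrite es ek leq_subr eqxx mul1r big1 ?addr0 // => s.
case/andP => /and3P[_ /andP[les _] /eqP ek'] /eqP[]; apply: val_inj => /=.
by have := ltn_ord s; lia.
Qed.

(** The subtracted term is the one with [k = (size u).-1], the overlap in a single letter; overlaps
    in at least two letters remain. *)
Lemma tautildeE (R : nzRingType) (N : nat) (P : 'M[R]_N) (v u : seq 'I_N) (k : nat) :
  v != [::] -> u != [::] ->
  tautilde P v u k = ((k < (size u).-1)%N && suffix (take (size u - k) u) v)%:R
                     * deltaw P (drop (size u - k).-1 u).
Proof.
move=> v0 u0; rewrite /tautilde tauE /zpow /cidx.
have {v0} v0 : (0 < size v)%N by case: v v0.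
have {u0} u0 : (0 < size u)%N by case: u u0.
case: (ltngtP k (size u).-1) => [ltk|gtk|->] /=.
- have -> : (k < size u)%N by lia.
  by rewrite !mul0r subr0.
- have -> : (k < size u)%N = false by lia.
  by rewrite !mul0r subr0.
have -> : (size u - (size u).-1 = 1)%N by lia.
have -> : (size v - (size v).-1 = 1)%N by lia.
have -> : ((size u).-1 < size u)%N by lia.
rewrite suffixE size_takel // drop0 mul1r u0 /= subn1.
by rewrite mul0r subrr.
Qed.

(* The term [z^k] of [tautilde] glues the last [k] letters of [u] to a word ending
   in [v]; as [G] is reduced, [v] cannot lie inside [u], so whenever the glued word
   ends in [u] the overlap condition of [tautilde] holds. *)
Lemma tautilde_Gser (R : realFieldType) (N : nat) (A : 'M[bool]_N)
    (P : 'M[R]_N) (p : 'I_N -> R) (G : seq (seq 'I_N)) (v u : seq 'I_N) (k n : nat) :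
  irreducible01 A -> (forall i j, 0 <= P i j) ->
  (forall i j, (0 < P i j) = A i j) ->
  reduced G -> [::] \notin G -> v \in G -> u \in G -> (k <= n)%N ->
  tautilde P v u k * Gser A p P G v (n - k)
  = wsum n (fun w =>
      [&& (k < (size u).-1)%N, suffix u w & end_occ G v (take (n - k) w)]%:R
      * muC p P w).
Proof.
move=> irrA P0 PA redG nilG vG uG le_kn.
have nz g : g \in G -> g != [::] by move=> gG; apply: contraNneq nilG => <-.
rewrite tautildeE ?nz // (Gser_wsum _ _ irrA) // wsumZl.
case: ltnP => [ltk|_] /=; last first.
  by rewrite /wsum !big1 // => w _; rewrite !mul0r.
(* [r] is the length of the overlap of [v] with [u]. *)
pose r := (size u - k)%N; rewrite -/r.
have ru : (0 < r <= size u)%N by rewrite /r; lia.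
pose f w := (suffix (take r u) v && end_occ G v (take (n - k) w))%:R * muC p P w.
transitivity (wsum (n - k)%N (fun x => f (x ++ drop r u))).
  apply: eq_wsum => x sx; rewrite /f take_size_cat //.
  case: (boolP (suffix _ v)) => /= [uv|_]; last by rewrite !mul0r.
  case: (boolP (end_occ G v x)) => /= [/andP[vx _]|_]; last by rewrite !mul0r mulr0.
  rewrite !mul1r; case/suffixP: (suffix_trans uv vx) => y ->.
  (* The last letter [a] of the overlap is where [muC_cat] cuts the glued word, so the coefficient
     of [tautilde] is the factor contributed by the appended letters. *)
  have [a [t et]] : exists a t, drop r.-1 u = a :: t.
    case e: (drop r.-1 u) => [|a t]; last by exists a, t.
    by move/(congr1 size): e; rewrite size_drop /=; lia.
  have ea : take r u = rcons (take r.-1 u) a.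
    rewrite -{1}(cat_take_drop r.-1 u) et take_cat size_takel; last by lia.
    have -> : (r < r.-1)%N = false by lia.
    have -> : (r - r.-1 = 1)%N by lia.
    by rewrite /= take0 cats1.
  have eb : drop r u = t.
    have -> : r = (1 + r.-1)%N by lia.
    by rewrite -drop_drop et /= drop0.
  by rewrite ea eb et -rcons_cat muC_cat mulrC.
rewrite (wsum_append (n := n)); last by rewrite size_drop /r; lia.
apply: eq_wsum => w sw; rewrite /f mulrA -natrM mulnb; congr ((nat_of_bool _)%:R * _).
case: (boolP (end_occ _ _ _)) => [/andP[vw _]|_]; last by rewrite !andbF.
rewrite !andbT; apply/andP/idP => [[/eqP ew uv]|uw].
  rewrite -(cat_take_drop (n - k) w) ew.
  case/suffixP: (suffix_trans uv vw) => y ->.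
  by rewrite -catA cat_take_drop suffix_suffix.
have [y ew] : exists y : seq 'I_N, w = y ++ u by exact/suffixP.
have sy : (n - k = size y + r)%N by move: sw; rewrite ew size_cat /r; lia.
have et : take (n - k) w = y ++ take r u.
  rewrite ew sy take_cat.
  have -> : (size y + r < size y)%N = false by lia.
  by rewrite addKn.
split.
  rewrite ew sy drop_cat.
  have -> : (size y + r < size y)%N = false by lia.
  by rewrite addKn.
rewrite et in vw.
case: (leqP (size (take r u)) (size v)) => [le|lt].
  by apply: suffix_comparable vw le; exact: suffix_suffix.
have vu : suffix v (take r u).
  by apply: suffix_comparable vw (suffix_suffix _ _) (ltnW lt).
have ne : v != u.
  by apply: contraTneq lt => ->; rewrite -leqNgt size_take; case: ltnP; lia.
have := redG _ _ vG uG ne.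
by rewrite (infix_trans (suffixW vu)) // infix_take.
Qed.

(* Telescoping over the prefixes of [w] that end strictly inside [u]: the first
   prefix containing a word of [G] is reached there because [u] ends [w]. *)
Lemma sum_end_occ_prefix (R : pzRingType) (N : nat) (G : seq (seq 'I_N))
    (u w : seq 'I_N) :
  uniq G -> reduced G -> [::] \notin G -> u \in G -> suffix u w ->
  \sum_(v <- G | (1 < size v)%N) \sum_(k < (size w).+1)
    ((k < (size u).-1)%N && end_occ G v (take (size w - k) w))%:R
  = (avoidsb G (take (size w - (size u).-1) w))%:R :> R.
Proof.
move=> uG redG nilG inu suw.
have u0 : (0 < size u)%N by case: u inu nilG {suw} => // ->.
have luw : (size u <= size w)%N := size_suffix suw.
rewrite exchange_big /=.
(* [f k] indicates that [w] without its last [k] letters avoids [G]. *)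
pose f k : R := (avoidsb G (take (size w - k) w))%:R.
transitivity (\sum_(0 <= k < (size u).-1) (f k.+1 - f k)).
  have leL : ((size u).-1 <= (size w).+1)%N by lia.
  rewrite big_mkord (big_ord_widen _ (fun k => f k.+1 - f k) leL).
  rewrite [RHS]big_mkcond; apply: eq_bigr => -[k /= _] _; case: ltnP => ltk /=; last exact: big1.
  rewrite /f; have -> : take (size w - k.+1) w
            = take (size (take (size w - k) w)).-1 (take (size w - k) w).
    by rewrite size_takel ?leq_subr // take_takel ?subnS ?leq_pred.
  (* A one-letter [v] ending this prefix would be a letter of [u], as the prefix ends inside [u];
     since [u] has length at least two, this contradicts reducedness. *)
  rewrite -sum_end_occ // big_mkcond; apply: eq_big_seq => v vG.
  case: ltnP => // v1; case: (boolP (end_occ _ _ _)) => // /andP[vw _].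
  have [y ew] : exists y : seq 'I_N, w = y ++ u by exact/suffixP.
  have et : take (size w - k) w = y ++ take (size u - k) u.
    rewrite ew take_cat size_cat.
    have -> : (size y + size u - k < size y)%N = false by lia.
    by rewrite -addnBA ?addKn //; lia.
  rewrite et in vw.
  have le : (size v <= size (take (size u - k) u))%N.
    by apply: leq_trans v1 _; rewrite size_takel ?leq_subr //; lia.
  have vu := suffix_comparable vw (suffix_suffix _ _) le.
  have ne : v != u by apply: contraTneq v1 => ->; rewrite -ltnNge; lia.
  have := redG _ _ vG inu ne.
  by rewrite (infix_trans (suffixW vu)) // infix_take.
(* The lower end [f 0] vanishes because [w] itself contains [u]. *)
rewrite telescope_sumr //= /f subn0 take_size.
have -> : avoidsb G w = false.
  by apply/negP => /allP/(_ _ inu)/negP; apply; exact: suffixW.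
by rewrite subr0.
Qed.

(** * Comparison of coefficients in the two identities *)

Theorem theorem4p5 (R : realFieldType) (N : nat) (A : 'M[bool]_N)
  (P : 'M[R]_N) (p : 'I_N -> R) (G : seq (seq 'I_N)) :
  irreducible01 A ->
  (forall i j, 0 <= P i j) ->
  (forall i j, (0 < P i j) = A i j) ->
  (forall i, \sum_(j < N) P i j = 1) ->
  (forall i, 0 <= p i) ->
  \sum_(i < N) p i = 1 ->
  (forall j, \sum_(i < N) p i * P i j = p j) ->
  uniq G ->
  (forall w, w \in G -> w != [::] /\ allowed A w) ->
  (forall u v, u \in G -> v \in G -> u != v -> ~~ infix u v) ->
  (forall i : 'I_N, [:: i] \notin G -> forall n : nat,
     Fser A p P G i n - p i * zpow R 1 n
       + \sum_(v <- G | (1 < size v)%N) (endsym v i)%:R * Gser A p P G v n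
     = ps_mul (zpow R 1)
         (fun m => \sum_(j < N | [:: j] \notin G) Fser A p P G j m * P j i) n)
  /\
  (forall (a : 'I_N) (u' : seq 'I_N), a :: u' \in G -> (0 < size u')%N ->
     forall n : nat,
     ps_mul (zpow R (size (a :: u')).-1)
       (fun m => deltaw P (a :: u') * Fser A p P G a m) n
     = \sum_(v <- G | (1 < size v)%N)
         ps_mul (tautilde P v (a :: u')) (Gser A p P G v) n).
Proof.
move=> irrA P0 PA _ _ _ _ uG allG redG'.
have redG : reduced G by move=> u v uiG viG; exact: redG'.
have nilG : [::] \notin G by apply/negP => /allG[].
split=> [i iG n|a u' inu u'0 n].
  (* Degrees 0 and 1 are treated apart: [sum_Fser_mulP] needs a letter before the last one. *)
  rewrite ps_mul_zpow; case: n => [|[|n]].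
  - by rewrite /zpow /= mulr0 subrr add0r mul0r big1 // => v _; rewrite mulr0.
  - rewrite subnn mul1r [RHS]big1 => [|j _]; last by rewrite mul0r.
    rewrite (Fser_wsum _ _ _ _ irrA P0 PA) big1_seq => [|v /andP[v1 vG]].
      (* In degree 1 the only word is [[:: i]]; it avoids [G] and its measure [p i] is cancelled by
         the subtracted term. *)
      transitivity (wsum 0 (fun x : seq 'I_N =>
          (avoidsb G (x ++ [:: i]))%:R * muC p P (x ++ [:: i]))
        - p i * zpow R 1 1); last first.
        rewrite wsum0 /= deltaw1 /zpow !mulr1.
        suff -> : avoidsb G [:: i] by rewrite mul1r subrr.
        apply/allP => g gG; rewrite infixs1 negb_or.
        by rewrite (contraNneq _ nilG) ?(contraNneq _ iG) // => <-.
      rewrite addr0 (wsum_append (n := 1) (fun w => (avoidsb G w)%:R * muC p P w)) //.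
      congr (_ - _); apply: eq_wsum => w sw.
      by rewrite suffixE sw mulrA -natrM mulnb.
    rewrite (Gser_wsum _ _ irrA) // /wsum big1 ?mulr0 // => w _.
    rewrite /end_occ; case: (boolP (suffix v w)) => [/size_suffix|_]; last by rewrite mul0r.
    by rewrite size_tuple leqNgt v1.
  rewrite mul1r subn1 sum_Fser_mulP // /zpow mulr0 subr0.
  rewrite (Fser_wsum _ _ _ _ irrA P0 PA).
  rewrite [X in _ + X](_ : _ = wsum n.+2 (fun w =>
    \sum_(v <- G | (1 < size v)%N) (endsym v i && end_occ G v w)%:R * muC p P w)).
    rewrite wsumD; apply: eq_wsum => w _.
    by rewrite -mulr_suml -mulrDl sum_end_occ_last.
  rewrite -wsum_sum big_seq_cond [RHS]big_seq_cond; apply: eq_bigr => v /andP[vG _].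
  rewrite (Gser_wsum _ _ irrA) // wsumZl; apply: eq_wsum => w _.
  by rewrite mulrA -natrM mulnb.
set u := a :: u' in inu *.
transitivity (wsum n (fun w =>
  (suffix u w && avoidsb G (take (size w - (size u).-1) w))%:R * muC p P w)).
  rewrite ps_mul_zpow (Fser_wsum _ _ _ _ irrA P0 PA) wsumZl /=.
  case: leqP => [le_n|lt_n]; last first.
    rewrite mul0r /wsum big1 // => w _; case: (boolP (suffix u w)) => [/size_suffix|_].
      by rewrite size_tuple /= ltnNge (ltnW lt_n).
    by rewrite mul0r.
  rewrite mul1r.
  (* Gluing [u'] after a word ending in [a] gives exactly the words ending in [u]; the shared letter
     [a] makes [deltaw P u] the factor gained by the measure. *)
  pose f w := (suffix [:: a] (take (n - size u') w)
               && avoidsb G (take (n - size u') w))%:R * muC p P w.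
  transitivity (wsum (n - size u')%N (fun x => f (x ++ u'))).
    apply: eq_wsum => x sx; rewrite /f take_size_cat //.
    case: (boolP (suffix _ _)) => [/suffixP[y ->]|_]; last by rewrite !mul0r mulr0.
    by rewrite cats1 muC_cat /u mulrCA [X in _ * X]mulrC.
  rewrite (wsum_append (n := n)); last by rewrite subnK.
  apply: eq_wsum => w sw; rewrite /f mulrA -natrM mulnb andbA sw.
  congr ((nat_of_bool (_ && _))%:R * _).
  apply/andP/idP => [[/eqP ew /suffixP[y ey]]|/suffixP[y ew]].
    by rewrite -(cat_take_drop (n - size u') w) ew ey -catA suffix_suffix.
  have ey : w = rcons y a ++ u' by rewrite ew cat_rcons.
  have sy : (n - size u')%N = size (rcons y a) by rewrite -sw ey size_cat addnK.
  by rewrite sy ey drop_size_cat // take_size_cat // -cats1 suffix_suffix.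
transitivity (wsum n (fun w => \sum_(v <- G | (1 < size v)%N) \sum_(k < n.+1)
    [&& (k < (size u).-1)%N, suffix u w & end_occ G v (take (n - k) w)]%:R * muC p P w)).
  apply: eq_wsum => w sw.
  under eq_bigr do rewrite -mulr_suml.
  rewrite -mulr_suml; congr (_ * _).
  case: (boolP (suffix u w)) => [uw|_].
    by rewrite -(sum_end_occ_prefix _ uG redG nilG inu uw) sw.
  by rewrite big1 // => v _; rewrite big1 // => k _; rewrite andbF.
rewrite -wsum_sum big_seq_cond [RHS]big_seq_cond; apply: eq_bigr => v /andP[vG _].
rewrite -wsum_sum /ps_mul; apply: eq_bigr => k _.
by rewrite tautilde_Gser // -ltnS.
Qed.
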